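(* Let $k\ge 1$ be an integer and let $F:\mathbb{N}^k\to\mathbb{C}$ be an arbitrary arithmetic function of $k$ variables. Assume that the multiple series $$C_{F,k}:=\sum_{n_1,\ldots,n_k=1}^{\infty}\frac{(\mu*F)(n_1,\ldots,n_k)}{n_1\cdots n_k}$$ is absolutely convergent. Then $$\lim_{x\to\infty}\frac{1}{x(\log x)^{k-1}}\sum_{n_1\cdots n_k\le x}F(n_1,\ldots,n_k)=\frac{1}{(k-1)!}\,C_{F,k},$$ where the sum is over all $(n_1,\ldots,n_k)\in\mathbb{N}^k$ with $n_1\cdots n_k\le x$.
   Context: $\mathbb{N}=\{1,2,\ldots\}$. For $F,G:\mathbb{N}^k\to\mathbb{C}$ the convolution $F*G$ is defined by $$(F*G)(n_1,\ldots,n_k)=\sum_{d_1\mid n_1,\ldots,d_k\mid n_k}F(d_1,\ldots,d_k)\,G(n_1/d_1,\ldots,n_k/d_k).$$ The $k$-variable Möbius function is $\mu(n_1,\ldots,n_k)=\mu(n_1)\cdots\mu(n_k)$, where on the right $\mu$ is the classical Möbius function; it is the inverse of the $k$-variable constant function $1$ under this convolution. *)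

(* Defs.v *)
From HB Require Import structures.
From mathcomp Require Import all_boot all_order all_algebra finmap.
From mathcomp Require Import complex.
From mathcomp Require Import all_classical all_reals all_analysis.
From mathcomp.analysis.showcase Require summability.

Set Implicit Arguments.
Unset Strict Implicit.
Unset Printing Implicit Defensive.

Import Order.TTheory GRing.Theory Num.Theory.
Import numFieldNormedType.Exports.

Local Open Scope classical_set_scope.
Local Open Scope ring_scope.
Local Open Scope complex_scope.

(* Points of N^k, N = {1, 2, ...}, are the finite functions all of whose
   entries are positive.  An arithmetic function of k variables is a function
   on {ffun 'I_k -> nat} of which only the values on posvec k are ever used. *)
Definition posvec (k : nat) : set {ffun 'I_k -> nat} :=
  [set n | forall i, (0 < n i)%N].
Arguments posvec k : clear implicits.

(* mobius 0 = 1 is a junk value. *)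
Definition mobius (n : nat) : int :=
  if all (fun p => logn p n == 1%N) (primes n)
  then (-1) ^+ size (primes n) else 0.

Definition mobiusv (R : realType) (k : nat) (n : {ffun 'I_k -> nat}) : R[i] :=
  \prod_(i < k) (mobius (n i))%:~R.

(* For n in posvec k the index set is finite and contained in posvec k. *)
Definition convolution (R : realType) (k : nat)
    (F G : {ffun 'I_k -> nat} -> R[i]) (n : {ffun 'I_k -> nat}) : R[i] :=
  \sum_(d \in [set d : {ffun 'I_k -> nat} | forall i, (d i %| n i)%N])
    F d * G [ffun i => (n i %/ d i)%N].

Definition abs_cvg_series (R : realType) (k : nat)
    (a : {ffun 'I_k -> nat} -> R[i]) : Prop :=
  (\esum_(n in posvec k) (Normc.normc (a n))%:E < +oo)%E.

(* Limit of the sums over the finite subsets of N^k, directed by inclusion.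
   The regular algebra R[i]^o carries the topology of the norm of R[i]. *)
Definition multiseries (R : realType) (k : nat)
    (a : {ffun 'I_k -> nat} -> R[i]) : R[i] :=
  summability.sum (fun n => (if n \in posvec k then a n else 0) : R[i]^o).

Definition mobius_quotient (R : realType) (k : nat)
    (F : {ffun 'I_k -> nat} -> R[i]) (n : {ffun 'I_k -> nat}) : R[i] :=
  convolution (@mobiusv R k) F n / (\prod_(i < k) n i)%N%:R.

Definition hyperbolic_sum (R : realType) (k : nat)
    (F : {ffun 'I_k -> nat} -> R[i]) (x : R) : R[i] :=
  \sum_(n \in [set n : {ffun 'I_k -> nat} |
               posvec k n /\ (\prod_(i < k) n i)%N%:R <= x]) F n.

(* Main.v *)
(* Put g = mu * F and T(y) = #{m in N^k : m_1 ... m_k <= y}. Moebius inversion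
   gives F = 1 * g, so the hyperbolic sum of F at x is the sum over d of
   g(d) T(x / (d_1 ... d_k)). Induction on k, comparing sums of
   log^j(y/n) / n with telescoping differences of log^(j+1)(y/n) / (j+1), shows
     y max(0, log y - 1)^(k-1) <= (k-1)! T(y) <= y (log y + k - 1)^(k-1)
   for y >= 1 (the lower bound only for k >= 2). Hence, with D = d_1 ... d_k,
   the weight T(x/D) D / (x (log x)^(k-1)) of g(d) / D is bounded uniformly in
   x and d and tends to 1/(k-1)! for each d, and dominated convergence for the
   absolutely convergent series of the g(d) / D concludes. *)
Require Import Defs.
From mathcomp Require Import all_boot all_order all_algebra finmap.
From mathcomp Require Import complex.
From mathcomp Require Import all_classical all_reals all_analysis.
From mathcomp Require Import ring lra.
From mathcomp.analysis.showcase Require summability.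

Set Implicit Arguments.
Unset Strict Implicit.
Unset Printing Implicit Defensive.

Import Order.TTheory GRing.Theory Num.Theory.
Import numFieldNormedType.Exports.

Local Open Scope classical_set_scope.
Local Open Scope ring_scope.
Local Open Scope complex_scope.

(** * The Moebius function *)

Lemma mobius_sqr_dvd p n : prime p -> (0 < n)%N -> (p ^ 2 %| n)%N -> mobius n = 0.
Proof.
move=> pp n0 pn; rewrite /mobius; case: allP => // /(_ p).
rewrite pfactor_dvdn // in pn.
rewrite -logn_gt0 => /(_ (ltnW pn)) /eqP lp.
by rewrite lp in pn.
Qed.

Lemma mobius_mulp p n : prime p -> (0 < n)%N -> ~~ (p %| n)%N ->
  mobius (p * n) = - mobius n.
Proof.
move=> pp n0 pn; have p0 := prime_gt0 pp.
have lp0 : logn p n = 0 by apply/eqP; rewrite lognE pp n0 (negbTE pn).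
have perm : perm_eq (primes (p * n)) (p :: primes n).
  apply: uniq_perm; first exact: primes_uniq.
    by rewrite /= primes_uniq mem_primes (negbTE pn) !andbF.
  by move=> q; rewrite primesM // primes_prime // !inE.
rewrite /mobius (perm_all _ perm) (perm_size perm) /=.
rewrite lognM // lp0 addn0 logn_prime // eqxx exprS mulN1r.
have -> : all (fun q => logn q (p * n) == 1) (primes n) =
          all (fun q => logn q n == 1) (primes n).
  apply: eq_in_all => q; rewrite mem_primes => /and3P[pq _ qn].
  rewrite lognM // logn_prime // (_ : q == p = false) //.
  by apply: contraNF pn => /eqP <-.
by rewrite /=; case: (all _ _); rewrite ?oppr0.
Qed.

(** Let p be the least prime factor of n > 1. Divisors divisible by p^2 contribute 0, and those
    divisible by p exactly once are the p e with e a divisor prime to p, whose terms cancel those of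
    the e. *)
Lemma sum_mobius n : (0 < n)%N ->
  \sum_(d <- divisors n) mobius d = (n == 1)%:R.
Proof.
move=> n0; case: eqVneq => [->|n1]; first by rewrite big_seq1.
pose p := pdiv n; have pn : (p %| n)%N by exact: pdiv_dvd.
have pp : prime p by rewrite pdiv_prime // ltn_neqAle eq_sym n1.
have p0 := prime_gt0 pp.
rewrite (bigID (fun d => p %| d)%N) /= (bigID (fun d => p %| d %/ p)%N) /=.
rewrite [X in X + _ + _]big_seq_cond big1 => [|d /and3P[]]; last first.
  rewrite -dvdn_divisors // => dn pd pdp.
  rewrite (mobius_sqr_dvd pp) ?(dvdn_gt0 n0) //.
  by rewrite -(divnK pd) expnS expn1 dvdn_mul.
rewrite add0r.
have perm : perm_eq [seq d <- divisors n | (p %| d)%N && ~~ (p %| d %/ p)%N]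
   [seq (p * e)%N | e <- [seq d <- divisors n | ~~ (p %| d)%N]].
  apply: uniq_perm; first by rewrite filter_uniq ?divisors_uniq.
    rewrite map_inj_uniq ?filter_uniq ?divisors_uniq // => a b /eqP.
    by rewrite eqn_pmul2l // => /eqP.
  move=> d; rewrite mem_filter -dvdn_divisors //; apply/idP/mapP.
    move=> /andP[/andP[pd npd] dn]; exists (d %/ p)%N; last by rewrite mulnC divnK.
    by rewrite mem_filter npd -dvdn_divisors //= (dvdn_trans _ dn) // dvdn_div.
  move=> [e]; rewrite mem_filter -dvdn_divisors // => /andP[pe en] ->.
  rewrite dvdn_mulr //= mulKn // pe /= Gauss_dvd ?pn //.
  by rewrite prime_coprime.
rewrite -big_filter (perm_big _ perm) big_map -[X in _ + X]big_filter -big_split /=.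
rewrite big_seq big1 // => d; rewrite mem_filter -dvdn_divisors // => /andP[pd dn].
by rewrite mobius_mulp ?(dvdn_gt0 n0) // addNr.
Qed.

(** * Counting lattice points under a hyperbola *)

Definition ffun_cons (T : Type) (k : nat) (x : T) (m : {ffun 'I_k -> T}) :
    {ffun 'I_k.+1 -> T} :=
  [ffun i => if unlift ord0 i is Some j then m j else x].

Lemma big_ffun_cons (V : nmodType) (I : finType) (k : nat)
    (G : {ffun 'I_k.+1 -> I} -> V) :
  \sum_m G m = \sum_x \sum_(m : {ffun 'I_k -> I}) G (ffun_cons x m).
Proof.
rewrite pair_bigA /= (reindex (fun p : I * _ => ffun_cons p.1 p.2)) //=.
exists (fun m => (m ord0, [ffun j => m (lift ord0 j)])) => [[x m]|m] _ /=.
  congr pair; first by rewrite ffunE unlift_none.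
  by apply/ffunP => j; rewrite !ffunE liftK.
by apply/ffunP => i; rewrite !ffunE; case: unliftP => [j|] ->; rewrite ?ffunE.
Qed.

Lemma le_of_eq (disp : Order.disp_t) (T : porderType disp) (x y : T) :
  x = y -> (x <= y)%O.
Proof. by move=> ->. Qed.

Section hyperbolic_count.
Variable R : realType.
Implicit Types (y c : R) (k N : nat).

(* The value [m i : 'I_N] stands for the positive integer [(m i).+1], so this
   counts the points of {1, ..., N}^k below the hyperbola. *)
Definition hyperbolic_count k N y : R :=
  \sum_(m : {ffun 'I_k -> 'I_N}) ((\prod_(i < k) (m i).+1)%N%:R <= y)%R%:R.

(** Fixing the first coordinate: this recursion drives both inductions on the number of
    variables. *)
Lemma hyperbolic_countS k N y :
  hyperbolic_count k.+1 N y = \sum_(n < N) hyperbolic_count k N (y / n.+1%:R).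
Proof.
rewrite /hyperbolic_count big_ffun_cons; apply: eq_bigr => n _.
apply: eq_bigr => m _; rewrite big_ord_recl ffunE unlift_none natrM.
rewrite ler_pdivlMr ?ltr0n // mulrC.
by under eq_bigr do rewrite ffunE liftK.
Qed.

Lemma hyperbolic_count_ge0 k N y : 0 <= hyperbolic_count k N y.
Proof. by apply: sumr_ge0 => m _; rewrite ler0n. Qed.

Lemma hyperbolic_count_lt1 k N y : y < 1 -> hyperbolic_count k N y = 0.
Proof.
move=> y1; apply: big1 => m _; rewrite leNgt (lt_le_trans y1) //.
by rewrite ler1n prodn_gt0.
Qed.

Lemma hyperbolic_count1 N y :
  hyperbolic_count 1 N y = \sum_(n < N) (n.+1%:R <= y)%R%:R.
Proof.
rewrite hyperbolic_countS; apply: eq_bigr => n _.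
rewrite /hyperbolic_count; under eq_bigr do rewrite big_ord0 ler_pdivlMr ?ltr0n // mul1r.
by rewrite sumr_const card_ffun !card_ord expn0.
Qed.

Lemma hyperbolic_count1_le N y : 0 <= y -> hyperbolic_count 1 N y <= y.
Proof.
rewrite hyperbolic_count1 => y0; elim: N => [|N IH]; first by rewrite big_ord0.
rewrite big_ord_recr /=; case: (leP N.+1%:R y) => [Ny|_]; last by rewrite addr0.
apply: le_trans Ny; rewrite -natr1 lerD2r.
rewrite (le_trans (ler_sum _ (_ : forall n, _ -> _ <= 1))) //.
  by move=> n _; case: (_ <= y).
by rewrite sumr_const card_ord.
Qed.

(** With [y <= N%:R] the box cuts off no point below the hyperbola; all lower bounds carry this
    condition. *)
Lemma hyperbolic_count1_ge N y : y <= N%:R -> y - 1 <= hyperbolic_count 1 N y.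
Proof.
rewrite hyperbolic_count1; elim: N y => [|N IH] y yN.
  by rewrite big_ord0; lra.
case: (leP y N%:R) => [/IH yN'|yN'].
  by rewrite big_ord_recr /=; apply: le_trans yN' _; rewrite lerDl ler0n.
rewrite big_ord_recr /= (eq_bigr (fun=> 1)) => [|n _].
  rewrite sumr_const card_ord; apply: le_trans (_ : N%:R <= _); last by rewrite lerDl ler0n.
  by rewrite lerBlDr natr1.
by rewrite (le_trans _ (ltW yN')) ?ler_nat.
Qed.

(** A discrete mean value estimate: a^(j+1) - b^(j+1) is a - b times a sum of j+1 monomials of
    degree j, each at least b^j. In [exprB_le] each is at most a^j. *)
Lemma exprB_ge j (a b : R) : 0 <= b -> b <= a ->
  (a - b) * b ^+ j * j.+1%:R <= a ^+ j.+1 - b ^+ j.+1.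
Proof.
move=> b0 ba; rewrite subrXX -mulrA ler_wpM2l ?subr_ge0 //.
rewrite mulr_natr (_ : _ *+ _ = \sum_(i < j.+1) b ^+ j); last by rewrite sumr_const card_ord.
apply: ler_sum => i _; rewrite -[in leLHS](subnK (ltn_ord i : (i <= j)%N)).
by rewrite exprD /= ler_wpM2r ?exprn_ge0 // lerXn2r ?nnegrE // (le_trans b0).
Qed.

Lemma exprB_le j (a b : R) : 0 <= b -> b <= a ->
  a ^+ j.+1 - b ^+ j.+1 <= (a - b) * a ^+ j * j.+1%:R.
Proof.
move=> b0 ba; rewrite subrXX -mulrA ler_wpM2l ?subr_ge0 //.
rewrite mulr_natr (_ : _ *+ _ = \sum_(i < j.+1) a ^+ j); last by rewrite sumr_const card_ord.
apply: ler_sum => i _; rewrite -[in leRHS](subnK (ltn_ord i : (i <= j)%N)).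
by rewrite exprD /= ler_wpM2l ?exprn_ge0 ?lerXn2r ?nnegrE // (le_trans b0).
Qed.

(** From ln (1 + t) <= t with t = 1/(n+1); [lnS_ge] takes t = -1/(n+2). *)
Lemma lnS_le n : ln n.+2%:R - ln n.+1%:R <= n.+1%:R^-1 :> R.
Proof.
rewrite -ln_div ?posrE ?ltr0n // -[n.+2]addn1 natrD mulrDl divff ?pnatr_eq0 // mul1r.
by apply: le_ln1Dx; rewrite (lt_le_trans (ltrN10 _)) // invr_ge0 ler0n.
Qed.

Lemma lnS_ge n : n.+2%:R^-1 <= ln n.+2%:R - ln n.+1%:R :> R.
Proof.
rewrite -opprB lerNr -ln_div ?posrE ?ltr0n //.
have -> : n.+1%:R / n.+2%:R = 1 + - n.+2%:R^-1 :> R.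
  by rewrite -[n.+1%:R](addrK 1) natr1 mulrBl divff ?pnatr_eq0 // mul1r.
by apply: le_ln1Dx; rewrite ltrN2 invf_lt1 ?ltr0n // ltr1n.
Qed.

(** The positive part of ln (y / (n+1)) - c. Cutting at 0 keeps the bases nonnegative, as [exprB_le]
    requires. *)
Definition lnpos c y n := Num.max 0 (ln y - c - ln n.+1%:R).

(* With [w n := ln (y / n.+1) + c], the mean value estimate of
   [w n ^+ j.+1 - w n.+1 ^+ j.+1] makes every term but the first telescope. *)
Lemma sum_ln_pow_le j c N y : 0 <= c -> 1 <= y ->
  \sum_(n < N) (if n.+1%:R <= y then n.+1%:R^-1 * (ln (y / n.+1%:R) + c) ^+ j else 0)
  <= (ln y + c) ^+ j + (ln y + c) ^+ j.+1 / j.+1%:R.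
Proof.
move=> c0 y1; have y0 : 0 < y by exact: lt_le_trans y1.
(* The maximum with 0 keeps [w] nonnegative and nonincreasing beyond y, so the telescoping needs no
   case distinction. *)
pose w n := Num.max 0 (ln y - ln n.+1%:R) + c.
have w0 n : 0 <= w n by rewrite addr_ge0 // le_max lexx.
have wdecr n : w n.+1 <= w n.
  rewrite lerD2r ge_max !le_max lexx /=; apply/orP; right.
  by rewrite lerD2l lerN2 ler_ln ?posrE ?ltr0n // ler_nat.
have wE n : n.+1%:R <= y -> w n = ln (y / n.+1%:R) + c.
  move=> ny; rewrite ln_div ?posrE ?ltr0n // /w; congr (_ + c).
  by apply/max_idPr; rewrite subr_ge0 ler_ln ?posrE ?ltr0n.
have w0E : w 0 = ln y + c by rewrite wE // divr1.
rewrite -w0E.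
pose f n := if n.+1%:R <= y then n.+1%:R^-1 * (ln (y / n.+1%:R) + c) ^+ j else 0.
rewrite -[leLHS]/(\sum_(n < N) f n).
have f_le n : f n.+1 <= (w n ^+ j.+1 - w n.+1 ^+ j.+1) / j.+1%:R.
  rewrite ler_pdivlMr ?ltr0n // (le_trans _ (exprB_ge _ (w0 _) (wdecr _))) //.
  rewrite ler_wpM2r // /f; case: ifPn => [ny|_]; last first.
    by rewrite mulr_ge0 ?exprn_ge0 // subr_ge0.
  rewrite -wE // ler_wpM2r ?exprn_ge0 //.
  have ny' : n.+1%:R <= y by rewrite (le_trans _ ny) ?ler_nat.
  rewrite (wE _ ny) (wE _ ny') !ln_div ?posrE ?ltr0n //.
  by apply: le_trans (lnS_ge n) _; apply: le_of_eq; ring.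
suff Hsum M : \sum_(n < M.+1) f n <= w 0 ^+ j + (w 0 ^+ j.+1 - w M ^+ j.+1) / j.+1%:R.
  case: N => [|N]; first by rewrite big_ord0 addr_ge0 ?divr_ge0 ?exprn_ge0.
  apply: le_trans (Hsum N) _; rewrite lerD2l ler_wpM2r ?invr_ge0 //.
  by rewrite gerBl exprn_ge0.
elim: M => [|M IH].
  by rewrite big_ord1 subrr mul0r addr0 /f y1 invr1 mul1r mulr1 w0E.
rewrite big_ord_recr /=; apply: le_trans (lerD IH (f_le M)) _.
by rewrite -addrA -mulrDl addrA subrK.
Qed.

(** Each term dominates the difference of [lnpos c y n ^+ j.+1 / j.+1%:R] from n to n+1. These
    differences telescope, and the end term at N vanishes because y <= N and c >= 0. *)
Lemma sum_lnpos_pow_ge j c N y : 0 <= c -> 0 < y -> y <= N%:R ->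
  lnpos c y 0 ^+ j.+1 / j.+1%:R <=
  \sum_(n < N) (if n.+1%:R <= y then n.+1%:R^-1 * lnpos c y n ^+ j else 0).
Proof.
move=> c0 y0 yN; pose w := lnpos c y.
have w0 n : 0 <= w n by rewrite le_max lexx.
have wdecr n : w n.+1 <= w n.
  rewrite ge_max !le_max lexx /=; apply/orP; right.
  by rewrite lerD2l lerN2 ler_ln ?posrE ?ltr0n // ler_nat.
have wE0 n : y <= n.+1%:R -> w n = 0.
  move=> ny; apply/max_idPl.
  rewrite -(ler_ln (y0 : y \is Num.pos) (ltr0Sn _ _ : n.+1%:R \is Num.pos)) in ny; lra.
have -> : lnpos c y 0 = w 0 by [].
pose f n := if n.+1%:R <= y then n.+1%:R^-1 * lnpos c y n ^+ j else 0.
rewrite -[leRHS]/(\sum_(n < N) f n).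
have f_ge n : (w n ^+ j.+1 - w n.+1 ^+ j.+1) / j.+1%:R <= f n.
  rewrite ler_pdivrMr ?ltr0n // (le_trans (exprB_le _ (w0 _) (wdecr _))) //.
  rewrite ler_wpM2r // /f; case: ifPn => [ny|]; last first.
    by rewrite -ltNge => /ltW ny; rewrite !wE0 ?subrr ?mul0r // (le_trans ny) ?ler_nat.
  rewrite ler_wpM2r ?exprn_ge0 // /w /lnpos.
  have := lnS_le n; have : 0 <= n.+1%:R^-1 :> R by rewrite invr_ge0.
  move: (ln n.+2%:R) (ln n.+1%:R) (n.+1%:R^-1) => p q r r0 h.
  rewrite lerBlDr ge_max; apply/andP; split; first by rewrite addr_ge0 ?le_max ?lexx.
  by rewrite -lerBlDl le_max; apply/orP; right; lra.
suff Hsum M : (w 0 ^+ j.+1 - w M ^+ j.+1) / j.+1%:R <= \sum_(n < M) f n.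
  by apply: le_trans (Hsum N); rewrite (wE0 N) ?expr0n ?subr0 // (le_trans yN) ?ler_nat.
elim: M => [|M IH]; first by rewrite big_ord0 subrr mul0r.
rewrite big_ord_recr /=; apply: le_trans (lerD IH (f_ge M)).
by rewrite -mulrDl addrA subrK.
Qed.

(** With a = ln y + k, summing the induction hypothesis over the first coordinate gives y / k! times
    a^k + a^(k+1) / (k+1). The shift from k to k+1 absorbs a^k, since (a+1)^(k+1) - a^(k+1) >= (k+1)
    a^k. *)
Lemma hyperbolic_count_le k N y : 1 <= y ->
  hyperbolic_count k.+1 N y <= y * ((ln y + k%:R) ^+ k / k`!%:R).
Proof.
elim: k y => [|k IH] y y1; have y0 : 0 < y by exact: lt_le_trans y1.
  by rewrite expr0 fact0 divr1 mulr1 hyperbolic_count1_le // ltW.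
rewrite hyperbolic_countS.
pose f n := if n.+1%:R <= y then n.+1%:R^-1 * (ln (y / n.+1%:R) + k%:R) ^+ k else 0.
apply: (@le_trans _ _ (\sum_(n < N) f n * (y / k`!%:R))).
  apply: ler_sum => n _; rewrite /f; case: ifPn => [ny|].
    apply: le_trans (IH _ _) _; first by rewrite ler_pdivlMr ?ltr0n // mul1r.
    by apply: le_of_eq; ring.
  by rewrite -ltNge mul0r => yn; rewrite hyperbolic_count_lt1 // ltr_pdivrMr ?ltr0n // mul1r.
rewrite -mulr_suml; apply: le_trans (ler_wpM2r _ (sum_ln_pow_le k N (ler0n _ k) y1)) _.
  by rewrite divr_ge0 // ltW.
have L0 : 0 <= ln y + k%:R by rewrite addr_ge0 ?ln_ge0.
have -> : ln y + k.+1%:R = ln y + k%:R + 1 by rewrite -natr1 addrA.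
set a := ln y + k%:R in L0 *.
have ak : a ^+ k * k.+1%:R <= (a + 1) ^+ k.+1 - a ^+ k.+1.
  have := @exprB_ge k (a + 1) a L0.
  rewrite (_ : a + 1 - a = 1) ?mul1r; last by rewrite addrAC subrr add0r.
  by apply; rewrite lerDl.
rewrite mulrCA ler_wpM2l ?(ltW y0) // factS natrM invfM mulrA.
rewrite ler_wpM2r ?invr_ge0 // ler_pdivlMr ?ltr0n // mulrDl divfK ?pnatr_eq0 //.
lra.
Qed.

(** The induction starts at two variables, where rounding down each y/n costs at most 1 for each n
    <= y, hence at most y in total. This is the 1 in [lnpos 1]; later steps keep it unchanged. *)
Lemma hyperbolic_count_ge k N y : 0 < y -> y <= N%:R ->
  y * (lnpos 1 y 0 ^+ k.+1 / k.+1`!%:R) <= hyperbolic_count k.+2 N y.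
Proof.
elim: k y => [|k IH] y y0 yN.
  rewrite expr1 divr1 hyperbolic_countS.
  apply: (@le_trans _ _ (\sum_(n < N) (if n.+1%:R <= y then y / n.+1%:R - 1 else 0))).
    rewrite /lnpos maxr_pMr ?(ltW y0) // mulr0 ge_max; apply/andP; split.
      apply: sumr_ge0 => n _; case: ifPn => // ny.
      by rewrite subr_ge0 ler_pdivlMr ?ltr0n // mul1r.
    rewrite ln1 subr0 mulrBr mulr1.
    (* The sum is y times a harmonic sum, the case j = 0, c = 0 of [sum_lnpos_pow_ge], minus the
       number of its terms. *)
    have -> : \sum_(n < N) (if n.+1%:R <= y then y / n.+1%:R - 1 else 0) =
        y * (\sum_(n < N) (if n.+1%:R <= y then n.+1%:R^-1 * lnpos 0 y n ^+ 0 else 0)) -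
        hyperbolic_count 1 N y.
      rewrite hyperbolic_count1 mulr_sumr -sumrB; apply: eq_bigr => n _.
      by case: ifP => _; rewrite ?mulr1 // mulr0 subr0.
    rewrite lerB ?hyperbolic_count1_le ?(ltW y0) // ler_wpM2l ?(ltW y0) //.
    apply: le_trans (sum_lnpos_pow_ge 0 (lexx 0) y0 yN).
    by rewrite expr1 divr1 le_max ln1 !subr0 lexx orbT.
  apply: ler_sum => n _; case: ifPn => _; last exact: hyperbolic_count_ge0.
  apply: hyperbolic_count1_ge.
  by rewrite ler_pdivrMr ?ltr0n // (le_trans yN) // ler_peMr // ler1n.
rewrite hyperbolic_countS.
apply: (@le_trans _ _ (y / k.+1`!%:R * (lnpos 1 y 0 ^+ k.+2 / k.+2%:R))).
  by rewrite [k.+2`!]factS natrM invfM; apply: le_of_eq; ring.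
apply: le_trans (ler_wpM2l _ (sum_lnpos_pow_ge k.+1 ler01 y0 yN)) _.
  by rewrite divr_ge0 // ltW.
rewrite mulr_sumr; apply: ler_sum => n _; case: ifPn => _; last first.
  by rewrite mulr0 hyperbolic_count_ge0.
apply: le_trans (IH _ _ _); last 2 first.
- by rewrite divr_gt0 // ltr0n.
- by rewrite ler_pdivrMr ?ltr0n // (le_trans yN) // ler_peMr // ler1n.
(* Replacing y by y / (n+1) in [lnpos 1 y 0] gives [lnpos 1 y n]. *)
rewrite /lnpos ln_div ?posrE ?ltr0n // ln1 subr0.
rewrite (_ : ln y - ln n.+1%:R - 1 = ln y - 1 - ln n.+1%:R); last by rewrite addrAC.
by apply: le_of_eq; ring.
Qed.

End hyperbolic_count.

(** * Bounds and limit of the normalised lattice point count *)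

Section hyperbolic_count_asymptotics.
Variable R : realType.

Lemma cvg_ln_pinfty : ln x @[x --> +oo] --> (+oo : set_system R).
Proof.
apply/cvgryPge => A; near=> x.
have Ax : expR A < x by near: x; apply: nbhs_pinfty_gt; exact: num_real.
by rewrite -[A]expRK ler_ln ?posrE ?expR_gt0 ?(lt_trans (expR_gt0 A)) // ltW.
Unshelve. all: end_near.
Qed.

Lemma cvg_ln_ratio (c : R) k :
  ((ln x + c) / ln x) ^+ k / k`!%:R @[x --> +oo] --> (k`!%:R^-1 : R).
Proof.
rewrite [X in _ --> X](_ : _ = 1 ^+ k / k`!%:R :> R); last by rewrite expr1n mul1r.
have lnV : (ln x)^-1 @[x --> +oo] --> (0 : R).
  apply/gtr0_cvgV0; last exact: cvg_ln_pinfty.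
  near=> x; have x1 : 1 < x by near: x; apply: nbhs_pinfty_gt; exact: num_real.
  exact: ln_gt0.
have H : (ln x + c) / ln x @[x --> +oo] --> (1 : R).
  rewrite [X in _ --> X](_ : _ = 1 + c * 0 :> R); last by rewrite mulr0 addr0.
  apply: (@cvg_trans _ ((1 + c * (ln x)^-1) @[x --> +oo])); last first.
    by apply: cvgD; [exact: cvg_cst | exact: cvgMl_tmp].
  apply: near_eq_cvg; near=> x.
  have x1 : 1 < x by near: x; apply: nbhs_pinfty_gt; exact: num_real.
  by rewrite mulrDl divff // gt_eqF // ln_gt0.
apply: cvgMr_tmp; exact: (cvg_comp _ (fun z : R => z ^+ k) H (@exprn_continuous R k 1)).
Unshelve. all: end_near.
Qed.

(** For x >= e one has ln x >= 1, hence ln (x/D) + k <= (k+1) ln x. If x/D < 1 the count is 0. The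
    bound is free of x and D, as dominated convergence demands. *)
Lemma hyperbolic_weight_le k N (x D : R) : expR 1 <= x -> 1 <= D ->
  hyperbolic_count k.+1 N (x / D) * D / (x * ln x ^+ k) <= k.+1%:R ^+ k / k`!%:R.
Proof.
move=> xe D1; have D0 : 0 < D by exact: lt_le_trans D1.
have x0 : 0 < x by exact: lt_le_trans (expR_gt0 _) xe.
have L1 : 1 <= ln x by rewrite -[1]expRK ler_ln ?posrE ?expR_gt0.
have [xD|xD] := ltP (x / D) 1.
  by rewrite hyperbolic_count_lt1 // !mul0r divr_ge0 ?exprn_ge0.
have L0 : 0 < ln x by exact: lt_le_trans L1.
rewrite ler_pdivrMr ?mulr_gt0 ?exprn_gt0 // -ler_pdivlMr //.
apply: le_trans (hyperbolic_count_le _ _ xD) _.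
rewrite [leRHS](_ : _ = x / D * ((ln x * k.+1%:R) ^+ k / k`!%:R)); last first.
  by rewrite exprMn; ring.
rewrite ler_wpM2l ?divr_ge0 ?(ltW x0) ?(ltW D0) // ler_wpM2r ?invr_ge0 // lerXn2r ?nnegrE ?addr_ge0 ?ln_ge0 ?mulr_ge0 ?(ltW L0) //.
rewrite ln_div ?posrE // -natr1 mulrDr mulr1 addrC lerD //.
  by rewrite ler_peMl.
by rewrite gerBl ln_ge0.
Qed.

(** The condition [1 + ln D <= ln x] makes the base nonnegative, so its powers compare with those of
    [lnpos]. The case k = 0 is one variable, which rests on [hyperbolic_count1_ge]. *)
Lemma hyperbolic_weight_ge k N (x D : R) : 0 < x -> 0 < D -> 0 < ln x ->
    x / D <= N%:R -> 1 + ln D <= ln x ->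
  (if k is 0 then 1 - D / x else ((ln x + (- ln D - 1)) / ln x) ^+ k / k`!%:R)
  <= hyperbolic_count k.+1 N (x / D) * D / (x * ln x ^+ k).
Proof.
move=> x0 D0 L0 xN LD.
have P0 : 0 < x * ln x ^+ k by rewrite mulr_gt0 // exprn_gt0.
rewrite ler_pdivlMr // -ler_pdivrMr //.
case: k P0 => [|k] P0.
  rewrite expr0 mulr1; apply: le_trans (hyperbolic_count1_ge xN).
  apply: le_of_eq; field.
  by rewrite !gt_eqF.
apply: le_trans (hyperbolic_count_ge _ _ xN); last by rewrite divr_gt0.
apply: (@le_trans _ _ (x / D * ((ln x + (- ln D - 1)) ^+ k.+1 / k.+1`!%:R))).
  rewrite exprMn exprVn; apply: le_of_eq.
  field.
  by rewrite !gt_eqF ?exprn_gt0 // ltr0n fact_gt0.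
rewrite ler_wpM2l ?divr_ge0 ?(ltW x0) ?(ltW D0) // ler_wpM2r ?invr_ge0 ?ler0n //.
rewrite lerXn2r ?nnegrE ?le_max ?lexx //; first by move: LD; lra.
by rewrite ln1 subr0 ln_div ?posrE // addrA lexx orbT.
Qed.

(** A squeeze: apart from the lower bound 1 - D/x for k = 0, both bounds are ((ln x + c) / ln x)^k /
    k! with c constant in x. The box size [N x] grows with x so that no point is lost. *)
Lemma hyperbolic_weight_cvg k (N : R -> nat) (D : R) : 1 <= D ->
    (forall x, 0 <= x -> x <= (N x)%:R) ->
  hyperbolic_count k.+1 (N x) (x / D) * D / (x * ln x ^+ k) @[x --> +oo] -->
    (k`!%:R^-1 : R).
Proof.
move=> D1 Nx; have D0 : 0 < D by exact: lt_le_trans D1.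
pose lo x := if k is 0 then 1 - D / x else ((ln x + (- ln D - 1)) / ln x) ^+ k / k`!%:R.
apply: (@squeeze_cvgr _ _ _ _ lo (fun x => ((ln x + (- ln D + k%:R)) / ln x) ^+ k / k`!%:R)).
- near=> x.
  have x0 : 0 < x by near: x; apply: nbhs_pinfty_gt; exact: num_real.
  have xD : 1 <= x / D.
    by rewrite ler_pdivlMr // mul1r; near: x; apply: nbhs_pinfty_ge; exact: num_real.
  have xN : x / D <= (N x)%:R.
    by rewrite ler_pdivrMr // (le_trans (Nx _ (ltW x0))) // ler_peMr.
  have L0 : 0 < ln x.
    by rewrite ln_gt0 //; near: x; apply: nbhs_pinfty_gt; exact: num_real.
  have LD : 1 + ln D <= ln x.
    near: x; have /cvgryPge := cvg_ln_pinfty; exact.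
  have P0 : 0 < x * ln x ^+ k by rewrite mulr_gt0 // exprn_gt0.
  apply/andP; split; last first.
    rewrite ler_pdivrMr // -ler_pdivlMr //.
    apply: le_trans (hyperbolic_count_le _ _ xD) _.
    rewrite ln_div ?posrE // -addrA exprMn exprVn; apply: le_of_eq.
    field.
    by rewrite !gt_eqF ?exprn_gt0 // ltr0n fact_gt0.
  by rewrite /lo hyperbolic_weight_ge // ?(lt_le_trans ltr01).
- rewrite /lo {lo}; case: k => [|k]; last exact: cvg_ln_ratio.
  rewrite [X in _ --> X](_ : _ = 1 - D * 0 :> R); last by rewrite fact0 invr1 mulr0 subr0.
  apply: cvgB; first exact: cvg_cst.
  apply: cvgMl_tmp; apply/gtr0_cvgV0; last exact: cvg_id.
  by near=> x; near: x; apply: nbhs_pinfty_gt; exact: num_real.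
- exact: cvg_ln_ratio.
Unshelve. all: end_near.
Qed.

End hyperbolic_count_asymptotics.

(** * Regrouping sums along divisors *)

Section regrouping.
Variables k X : nat.
Implicit Types n d m : {ffun 'I_k -> nat}.

Definition vprod n := (\prod_(i < k) n i)%N.

Definition vdvd d n := [forall i, d i %| n i]%N.

Definition vdiv n d : {ffun 'I_k -> nat} := [ffun i => n i %/ d i]%N.

(** A duplicate-free list makes exchanging and reindexing sums direct. Entries run over 1, ..., X+1,
    which covers all points since each entry is at most the product; 'I_X.+1 is inhabited even for X
    = 0. *)
Definition hyperbolic_seq : seq {ffun 'I_k -> nat} :=
  [seq n <- [seq [ffun i => (m i : nat).+1] | m : {ffun 'I_k -> 'I_X.+1}]
     | (vprod n <= X)%N].

Lemma hyperbolic_seq_uniq : uniq hyperbolic_seq.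
Proof.
rewrite filter_uniq // map_inj_uniq ?enum_uniq // => a b /ffunP ab.
by apply/ffunP => i; apply/val_inj; move: (ab i); rewrite !ffunE => -[].
Qed.

Lemma le_vprod n i : (forall j, 0 < n j)%N -> (n i <= vprod n)%N.
Proof.
move=> n0; rewrite /vprod (bigD1 i) //= leq_pmulr // prodn_gt0 // => j.
Qed.

Lemma mem_hyperbolic_seq n :
  (n \in hyperbolic_seq) = [forall i, 0 < n i]%N && (vprod n <= X)%N.
Proof.
rewrite mem_filter andbC; case: leqP => nX; rewrite ?andbF // !andbT.
apply/mapP/forallP => [[m _ ->] i|n0]; first by rewrite ffunE.
exists [ffun i => inord (n i).-1]; first by rewrite mem_enum.
apply/ffunP => i; rewrite !ffunE inordK ?prednK //.
by rewrite (leq_trans (le_vprod i n0)) // leqW.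
Qed.

Lemma hyperbolic_seqP n :
  reflect ((forall i, 0 < n i)%N /\ (vprod n <= X)%N) (n \in hyperbolic_seq).
Proof.
rewrite mem_hyperbolic_seq; apply: (iffP andP) => -[].
  by move=> /forallP n0.
by move=> /forallP.
Qed.

Lemma vprod_gt0 n : n \in hyperbolic_seq -> (0 < vprod n)%N.
Proof. by move=> /hyperbolic_seqP[n0 _]; rewrite prodn_gt0. Qed.

Lemma vprod_dvd d n : vdvd d n -> (vprod d %| vprod n)%N.
Proof.
move=> /forallP dn; rewrite /vprod.
by elim/big_rec2 : _ => // i a b _ ab; exact: dvdn_mul.
Qed.

Lemma vprod_vdiv d n : vdvd d n -> (vprod d * vprod (vdiv n d))%N = vprod n.
Proof.
move=> /forallP dn; rewrite /vprod -big_split /=; apply: eq_bigr => i _.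
by rewrite ffunE mulnC divnK.
Qed.

Lemma vdvd_mem d n : n \in hyperbolic_seq -> vdvd d n -> d \in hyperbolic_seq.
Proof.
move=> nA dn; have [n0 nX] := hyperbolic_seqP _ nA.
apply/hyperbolic_seqP; split.
  by move=> i; apply: dvdn_gt0 (n0 i) (forallP dn i).
by apply: leq_trans nX; apply: dvdn_leq (vprod_gt0 nA) (vprod_dvd dn).
Qed.

(** Coordinatewise multiplication by [d] is a bijection onto the multiples of [d], with inverse
    [vdiv^~ d]. *)
Lemma sum_multiples (V : nmodType) (f : {ffun 'I_k -> nat} -> V) d :
  d \in hyperbolic_seq ->
  \sum_(n <- hyperbolic_seq | vdvd d n) f (vdiv n d) =
  \sum_(m <- hyperbolic_seq | (vprod d * vprod m <= X)%N) f m.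
Proof.
move=> dA; have [d0 dX] := hyperbolic_seqP _ dA.
pose mul m : {ffun 'I_k -> nat} := [ffun i => d i * m i]%N.
have mulK m : vdiv (mul m) d = m by apply/ffunP => i; rewrite !ffunE mulKn.
have vmul m : vdvd d (mul m) by apply/forallP => i; rewrite ffunE dvdn_mulr.
have vprodM m : vprod (mul m) = (vprod d * vprod m)%N by rewrite -(vprod_vdiv (vmul m)) mulK.
rewrite -big_filter -[RHS]big_filter.
have perm : perm_eq [seq n <- hyperbolic_seq | vdvd d n]
    [seq mul m | m <- [seq m <- hyperbolic_seq | (vprod d * vprod m <= X)%N]].
  apply: uniq_perm.
  - by rewrite filter_uniq // hyperbolic_seq_uniq.
  - rewrite map_inj_uniq; last exact: (can_inj (g := vdiv^~ d) mulK).
    exact: filter_uniq hyperbolic_seq_uniq.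
  move=> n; rewrite mem_filter; apply/andP/mapP.
    move=> [dn nA]; have [n0 nX] := hyperbolic_seqP _ nA.
    have dnE : n = mul (vdiv n d).
      by apply/ffunP => i; rewrite !ffunE mulnC divnK // (forallP dn i).
    exists (vdiv n d) => //; rewrite mem_filter vprod_vdiv // nX /=.
    apply: vdvd_mem nA _; apply/forallP => i; rewrite ffunE.
    by rewrite dvdn_div // (forallP dn i).
  move=> [m]; rewrite mem_filter => /andP[dmX mA] ->; split => //.
  have [m0 _] := hyperbolic_seqP _ mA.
  by apply/hyperbolic_seqP; rewrite vprodM; split => // i; rewrite ffunE muln_gt0 d0 m0.
by rewrite (perm_big _ perm) big_map; apply: eq_bigr => m _; rewrite mulK.
Qed.

(** Regrouping along n = d m leaves the constraint that the product of m and d is at most X; the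
    vanishing of [W] beyond X lets m range freely. *)
Lemma sum_convolution (V : pzSemiRingType) (f g : {ffun 'I_k -> nat} -> V) (W : nat -> V) :
  (forall p, (X < p)%N -> W p = 0) ->
  \sum_(n <- hyperbolic_seq)
     (\sum_(d <- hyperbolic_seq | vdvd d n) f d * g (vdiv n d)) * W (vprod n) =
  \sum_(d <- hyperbolic_seq) \sum_(m <- hyperbolic_seq) f d * g m * W (vprod d * vprod m)%N.
Proof.
move=> W0.
under eq_bigr do rewrite mulr_suml.
rewrite (exchange_big_dep xpredT) //=; apply: eq_big_seq => d dA.
transitivity (\sum_(n <- hyperbolic_seq | vdvd d n)
   (fun m => f d * g m * W (vprod d * vprod m)%N) (vdiv n d)).
  by apply: eq_bigr => n dn; rewrite /= vprod_vdiv.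
rewrite (sum_multiples (fun m => f d * g m * W (vprod d * vprod m)%N) dA).
rewrite [RHS](bigID (fun m => vprod d * vprod m <= X)%N) /= [X in _ + X]big1 ?addr0 //.
by move=> m; rewrite -ltnNge => /W0 ->; rewrite mulr0.
Qed.

(** An index range independent of n is what distributing a product over sums requires in
    [sum_mobiusv]. *)
Lemma sum_mobius_ord (n : nat) : (0 < n <= X.+1)%N ->
  \sum_(j < X.+1 | (j.+1 %| n)%N) mobius j.+1 = (n == 1)%:R.
Proof.
move=> /andP[n0 nX]; rewrite -sum_mobius //.
have perm : perm_eq (divisors n) [seq j.+1 | j <- [seq j <- iota 0 X.+1 | (j.+1 %| n)%N]].
  apply: uniq_perm; first exact: divisors_uniq.
    by rewrite map_inj_uniq ?filter_uniq ?iota_uniq // => a b [].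
  move=> d; rewrite -dvdn_divisors //; apply/idP/mapP => [dn|[j]].
    have d0 := dvdn_gt0 n0 dn.
    exists d.-1; rewrite ?prednK // mem_filter prednK // dn mem_iota /= add0n prednK //.
    by rewrite (leq_trans (dvdn_leq n0 dn)).
  by rewrite mem_filter => /andP[jn _] ->.
rewrite (perm_big _ perm) big_map big_filter.
by rewrite -[iota 0 _]/(index_iota 0 X.+1) big_mkord.
Qed.

(** The sum factors over the coordinates into one-variable Moebius sums. Extending it to the whole
    box is harmless: [G] vanishes off the divisors, and divisors of [n] satisfy the product
    bound. *)
Lemma sum_mobiusv (R : realType) n : n \in hyperbolic_seq ->
  \sum_(d <- hyperbolic_seq | vdvd d n) mobiusv R d = (n == [ffun=> 1%N])%:R.
Proof.
move=> nA; have [n0 nX] := hyperbolic_seqP _ nA.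
pose G i (j : 'I_X.+1) : R[i] := if (j.+1 %| n i)%N then (mobius j.+1)%:~R else 0.
transitivity (\sum_(m : {ffun 'I_k -> 'I_X.+1}) \prod_i G i (m i)).
  rewrite big_filter_cond big_image_cond /= big_mkcond /=; apply: eq_bigr => m _.
  case: ifPn => [/andP[_ /forallP mn]|].
    by apply: eq_bigr => i _; move: (mn i); rewrite /G ffunE => ->.
  move=> mn; apply/esym/eqP/prodf_eq0.
  case: (pickP (fun i => ~~ ((m i).+1 %| n i)%N)) => [i mi|mn'].
    by exists i => //; rewrite /G (negbTE mi).
  have dn : vdvd [ffun i => (m i : nat).+1] n.
    by apply/forallP => i; rewrite ffunE; move/negbFE: (mn' i).
  by case/negP: mn; rewrite dn (proj2 (hyperbolic_seqP _ (vdvd_mem nA dn))).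
rewrite -(bigA_distr_bigA G).
transitivity (\prod_i ((n i == 1)%N%:R : R[i])).
  apply: eq_bigr => i _; rewrite -big_mkcond /= -rmorph_sum /=.
  rewrite sum_mobius_ord ?n0 /=; first by rewrite natz.
  by rewrite (leq_trans (le_vprod i n0)) // leqW.
case: eqVneq => [->|n1]; first by apply: big1 => i _; rewrite ffunE.
apply/eqP/prodf_eq0; move: n1; rewrite -[n != _]negbK => /negPn n1.
case: (pickP (fun i => n i != 1%N)) => [i ni|all1].
  by exists i => //; rewrite (negbTE ni).
by case/eqP: n1; apply/ffunP => i; rewrite ffunE; apply/eqP; move: (all1 i) => /negbFE.
Qed.

(* Moebius inversion in summed form: the triple sum over (a, b, m) of
   mu(a) F(b) is regrouped first along d = ab and then along n = am. *)
Lemma sum_via_mobius (R : realType) (F : {ffun 'I_k -> nat} -> R[i]) :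
  \sum_(n <- hyperbolic_seq) F n =
  \sum_(d <- hyperbolic_seq)
    (\sum_(a <- hyperbolic_seq | vdvd a d) mobiusv R a * F (vdiv d a)) *
    \sum_(m <- hyperbolic_seq) (vprod d * vprod m <= X)%N%:R.
Proof.
pose W p : R[i] := (p <= X)%N%:R.
have W0 p q : (X < p)%N -> (0 < q)%N -> W (p * q)%N = 0.
  by move=> Xp q0; rewrite /W leqNgt (leq_trans Xp) ?leq_pmulr.
rewrite (sum_convolution (@mobiusv R k) F (W := fun p => \sum_(m <- hyperbolic_seq) W (p * vprod m)%N)); last first.
  by move=> p Xp; rewrite big_seq big1 // => m /vprod_gt0; exact: W0.
rewrite exchange_big; apply: eq_big_seq => b bA /=.
have b0 := vprod_gt0 bA.
(* The inner Moebius sum is the indicator of n = (1, ..., 1), whose weight is [W (vprod b)], equal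
   to 1 because b lies in the list. *)
transitivity (F b * \sum_(n <- hyperbolic_seq)
   (\sum_(a <- hyperbolic_seq | vdvd a n) mobiusv R a * 1) * W (vprod n * vprod b)%N).
  have oneA : [ffun=> 1%N] \in hyperbolic_seq.
    apply/hyperbolic_seqP; split=> [i|]; first by rewrite ffunE.
    rewrite /vprod; under eq_bigr do rewrite ffunE.
    by rewrite big1 // (leq_trans b0) //; have [] := hyperbolic_seqP _ bA.
  transitivity (F b * \sum_(n <- hyperbolic_seq)
      (n == [ffun=> 1%N])%:R * W (vprod n * vprod b)%N); last first.
    congr (_ * _); apply: eq_big_seq => n nA.
    by under eq_bigr do rewrite mulr1; rewrite sum_mobiusv.
  rewrite (bigD1_seq [ffun=> 1%N]) ?hyperbolic_seq_uniq //= big1 => [|n /negbTE ->].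
    rewrite eqxx mul1r addr0 /W [vprod [ffun=> _]]big1 => [|i _]; last by rewrite ffunE.
    by rewrite mul1n (proj2 (hyperbolic_seqP _ bA)) mulr1.
  by rewrite mul0r.
rewrite (sum_convolution (@mobiusv R k) (fun=> 1) (W := fun p => W (p * vprod b)%N)); last first.
  by move=> p Xp; exact: W0.
rewrite mulr_sumr; apply: eq_bigr => a _; rewrite !mulr_sumr.
by apply: eq_bigr => m _; rewrite mulr1 mulrCA mulrA mulnAC.
Qed.

End regrouping.

(** * Unordered sums of complex numbers *)

Section complex_norm.
Variable R : realType.
Implicit Types z : R[i].
Local Notation normc := (@Normc.normc R).

Lemma norm_normc z : `|z| = (normc z)%:C.
Proof. by case: z => a b; rewrite normc_def. Qed.

Lemma normc_ge0 z : 0 <= normc z.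
Proof. by rewrite -ler0c -norm_normc normr_ge0. Qed.

Lemma normc_sum (I : Type) (s : seq I) (P : pred I) (f : I -> R[i]) :
  normc (\sum_(i <- s | P i) f i) <= \sum_(i <- s | P i) normc (f i).
Proof.
elim/big_rec2 : _ => [|i a b _ ab]; first by rewrite Normc.normc0.
by apply: le_trans (le_normcD _ _) _; rewrite lerD2l.
Qed.

Lemma normc_le_ReIm z : normc z <= `|complex.Re z| + `|complex.Im z|.
Proof.
case: z => a b /=; rewrite -[leRHS]ger0_norm ?addr_ge0 // -sqrtr_sqr.
rewrite ler_sqrt ?sqr_ge0 // sqrrD !real_normK ?num_real // addrAC lerDl.
by rewrite mulrn_wge0 // mulr_ge0.
Qed.

Lemma Re_le_normc z : `|complex.Re z| <= normc z.
Proof.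
by case: z => a b /=; rewrite -sqrtr_sqr ler_sqrt ?addr_ge0 ?sqr_ge0 // lerDl sqr_ge0.
Qed.

Lemma Im_le_normc z : `|complex.Im z| <= normc z.
Proof.
by case: z => a b /=; rewrite -sqrtr_sqr ler_sqrt ?addr_ge0 ?sqr_ge0 // lerDr sqr_ge0.
Qed.

Lemma normc_real (r : R) : normc r%:C = `|r|.
Proof. by rewrite /= expr0n /= addr0 sqrtr_sqr. Qed.

(** The norm of [R[i]^o] is valued in [R[i]], so its epsilons are complex; being positive forces
    them to be real. *)
Lemma cvg_normcP (T : Type) (F : set_system T) {FF : Filter F} (f : T -> R[i]^o) (z : R[i]^o) :
  f x @[x --> F] --> z <->
  forall e : R, 0 < e -> \forall x \near F, normc (z - f x) <= e.
Proof.
split=> [/cvgrPdist_le fz e e0|fz].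
  have /fz : 0 < e%:C by rewrite ltcR.
  by apply: filterS => x; rewrite -(lecR (normc _)) -norm_normc.
apply/cvgrPdist_le => -[e i] /=; rewrite ltcE /= => /andP[/eqP -> /fz].
by apply: filterS => x; rewrite -(lecR (normc _)) -norm_normc.
Qed.

End complex_norm.

(** * Absolute summability and dominated convergence over finite sets *)

Section unordered_sums.
Variables (R : realType) (I : choiceType).
Local Notation normc := (@Normc.normc R).
Implicit Types (f : I -> R) (x : I -> R[i]).

(* The Cauchy criterion for unordered summability, when [f] is nonnegative. *)
Definition small_tails f := forall e, 0 < e -> exists J : {fset I},
  forall K : {fset I}, (forall i, i \in K -> i \notin J) -> \sum_(i <- K) f i <= e.

(** Take a finite set whose sum is within [e] of the supremum: a disjoint finite set adding more
    than [e] would push the union above the supremum. *)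
Lemma esum_small_tails f : (forall i, 0 <= f i) ->
  (\esum_(i in [set: I]) (f i)%:E < +oo)%E -> small_tails f.
Proof.
move=> f0 foo e e0.
have fin : (\esum_(i in [set: I]) (f i)%:E)%E \is a fin_num.
  by rewrite ge0_fin_numE // esum_ge0 // => i _; rewrite lee_fin.
have [_ [A [finA _] <-] HA] := ub_ereal_sup_adherent e0 fin.
have {HA} HA : (\esum_(i in [set: I]) (f i)%:E - e%:E < \sum_(i \in A) (f i)%:E)%E by [].
exists (fset_set A) => K KA.
have : ((\sum_(i <- (fset_set A `|` K)%fset) f i)%:E <= \esum_(i in [set: I]) (f i)%:E)%E.
  rewrite -sumEFin; apply: ereal_sup_ubound; exists [set` (fset_set A `|` K)%fset].
    by split => //; exact: finite_fset.
  by rewrite -fsbig_seq ?fset_uniq.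
rewrite (big_fsetID _ (mem (fset_set A))) /=.
have -> : [fset i in (fset_set A `|` K) | i \in fset_set A]%fset = fset_set A.
  by apply/fsetP => i; rewrite !inE /= andbC; case: (i \in fset_set A).
have -> : [fset i in (fset_set A `|` K) | i \notin fset_set A]%fset = K.
  apply/fsetP => i; rewrite !inE /=; have := KA i.
  by case: (i \in fset_set A); case: (i \in K) => //= /(_ isT).
move: HA; rewrite fsbig_finite //= sumEFin -(fineK fin) -EFinB lte_fin lee_fin.
move=> /=; lra.
Qed.

Lemma small_tails_sumB (V : normedZmodType R) (f : I -> R) (g : I -> V) (e : R) (J K : {fset I}) :
  (forall K : {fset I}, (forall i, i \in K -> i \notin J) -> \sum_(i <- K) f i <= e) ->
  (forall i, `|g i| <= f i) -> (J `<=` K)%fset ->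
  `|\sum_(i <- J) g i - \sum_(i <- K) g i| <= e.
Proof.
move=> HJ gf JK; rewrite (big_fsetID _ (mem J) K) /=.
have -> : [fset i in K | i \in J]%fset = J.
  by apply/fsetP => i; rewrite !inE /= andbC; case: (boolP (i \in J)) => // /(fsubsetP JK) ->.
rewrite opprD addrA subrr add0r normrN.
apply: le_trans (HJ [fset i in K | i \notin J]%fset _) => [|i]; last by rewrite !inE => /andP[].
by apply: le_trans (ler_norm_sum _ _ _) _; apply: ler_sum.
Qed.

Lemma cvg_small_tails f (g : I -> R) : small_tails f -> (forall i, `|g i| <= f i) ->
  cvg (\sum_(i <- K) g i @[K --> @summability.totally I]).
Proof.
move=> tails gf; have FF := @summability.totally_filter I.
apply: cauchy_cvg; apply: cauchy_exP => e e0.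
(* Halving [e] yields the strict inequality in the definition of a ball. *)
have [J HJ] := tails (e / 2) (divr_gt0 e0 (ltr0Sn R 1)).
exists (\sum_(i <- J) g i); exists J => // K /= JK.
rewrite /ball /=; apply: le_lt_trans (small_tails_sumB HJ gf JK) _.
by rewrite ltr_pdivrMr // ltr_pMr // ltr1n.
Qed.

Lemma complex_sum (s : seq I) x :
  \sum_(i <- s) x i = (\sum_(i <- s) complex.Re (x i)) +i* (\sum_(i <- s) complex.Im (x i)).
Proof.
elim: s => [|i s IH]; first by rewrite !big_nil.
by rewrite !big_cons IH; case: (x i).
Qed.

Lemma partial_sumE x (K : {fset I}) :
  summability.partial_sum (x : I -> R[i]^o) K = \sum_(i <- K) x i.
Proof. by rewrite big_seq_fsetE. Qed.

(** [summability.sum] is a limit operator, so convergence has to be proved first; it comes from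
    completeness of [R] applied to real and imaginary parts. *)
Lemma partial_sum_cvg x : small_tails (fun i => normc (x i)) ->
  summability.partial_sum (x : I -> R[i]^o) K @[K --> @summability.totally I] -->
    (summability.sum (x : I -> R[i]^o) : R[i]^o).
Proof.
move=> tails; have FF := @summability.totally_filter I.
have /cvg_ex[a Ha] := cvg_small_tails tails (fun i => Re_le_normc (x i)).
have /cvg_ex[b Hb] := cvg_small_tails tails (fun i => Im_le_normc (x i)).
suff H : summability.partial_sum (x : I -> R[i]^o) K @[K --> @summability.totally I] -->
    (a +i* b : R[i]^o).
  by rewrite /summability.sum (cvg_lim _ H) //; exact: norm_hausdorff.
apply/cvg_normcP => e e0.
have e20 : 0 < e / 2 by rewrite divr_gt0.
move/cvgrPdist_le : Ha => /(_ _ e20); move/cvgrPdist_le : Hb => /(_ _ e20).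
apply: (@filterS2 _ _ (@filter_filter _ _ FF)) => K Hb Ha.
rewrite partial_sumE complex_sum.
apply: le_trans (normc_le_ReIm _) _ => /=.
by move: Ha Hb; rewrite [e in _ -> _ -> _ <= e]splitr => Ha Hb; exact: lerD.
Qed.

(** One set [J] serves both purposes: enlarging it by a set [L] on which the partial sums are within
    e/2 of the limit changes the sum by a tail of at most e/2. *)
Lemma sum_approx x e : 0 < e -> small_tails (fun i => normc (x i)) ->
  exists2 J : {fset I},
    (forall K : {fset I}, (forall i, i \in K -> i \notin J) -> \sum_(i <- K) normc (x i) <= e) &
    normc (summability.sum (x : I -> R[i]^o) - \sum_(i <- J) x i) <= e.
Proof.
move=> e0 tails.
have e20 : 0 < e / 2 by rewrite divr_gt0.
have [J HJ] := tails _ e20; exists J.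
  by move=> K /HJ /le_trans; apply; rewrite ler_pdivrMr // ler_peMr ?(ltW e0) // ler1n.
have FF := @summability.totally_filter I.
have [L _ HL] := proj1 (@cvg_normcP R _ _ (@filter_filter _ _ FF) _ _)
  (partial_sum_cvg tails) _ e20.
have /HL /= H : [set B | L `<=` B]%fset (J `|` L)%fset by rewrite /= fsubsetUr.
rewrite partial_sumE in H.
rewrite -(subrKA (\sum_(i <- (J `|` L)%fset) x i)).
apply: le_trans (le_normcD _ _) _; rewrite [leRHS]splitr lerD //.
rewrite (big_fsetID _ (mem J)) /=.
have -> : [fset i in (J `|` L)%fset | i \in J]%fset = J.
  by apply/fsetP => i; rewrite !inE /= andbC; case: (i \in J).
rewrite addrAC subrr add0r.
apply: le_trans (normc_sum _ _ _) _.
by apply: HJ => i; rewrite !inE => /andP[].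
Qed.

(** The error splits into l times the tail of the series, a finite sum of x (l - w) over [J], and a
    weighted tail bounded through [C]. Convergence of the weights is asked only where x is nonzero,
    since the weights used later vanish at points with a zero entry. *)
Lemma dominated_sum_cvg (T : Type) (F : set_system T) (FF : ProperFilter F)
    x (A : T -> seq I) (w : T -> I -> R) (C l : R) :
  small_tails (fun i => normc (x i)) ->
  (\forall t \near F, [/\ uniq (A t), (forall i, i \notin A t -> w t i = 0) &
     forall i, `|w t i| <= C]) ->
  (forall i, x i != 0 -> w t i @[t --> F] --> l) ->
  (\sum_(i <- A t) x i * (w t i)%:C : R[i]^o) @[t --> F] -->
    (l%:C * summability.sum (x : I -> R[i]^o) : R[i]^o).
Proof.
move=> tails nearA wl; apply/cvg_normcP => e e0.
have C0 : 0 <= `|C| + `|l| by rewrite addr_ge0.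
(* The three errors are at most |l| d, d and |C| d, which add up to e. *)
pose d := e / (`|C| + `|l| + 1).
have d0 : 0 < d by rewrite divr_gt0 // ltr_wpDl.
have [J HJ HS] := sum_approx d0 tails.
have Jl : \sum_(i <- J) normc (x i) * `|w t i - l| @[t --> F] --> (0 : R).
  elim: (J : seq I) => [|i s IH].
    by under eq_cvg do rewrite big_nil; exact: cvg_cst.
  rewrite [X in _ --> X](_ : _ = 0 + 0 :> R); last by rewrite addr0.
  under eq_cvg do rewrite big_cons.
  apply: cvgD => //; have [->|xi] := eqVneq (x i) 0.
    by rewrite Normc.normc0; under eq_cvg do rewrite mul0r; exact: cvg_cst.
  rewrite [X in _ --> X](_ : _ = normc (x i) * 0 :> R); last by rewrite mulr0.
  apply: cvgMl_tmp; rewrite [X in _ --> X](_ : _ = `|l - l| :> R); last by rewrite subrr normr0.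
  by apply: cvg_norm; apply: cvgB; [exact: wl | exact: cvg_cst].
move/cvgrPdist_le : Jl => /(_ _ d0).
apply: filterS2 nearA => t [uA A0 wC]; rewrite sub0r normrN ger0_norm; last first.
  by apply: sumr_ge0 => i _; rewrite mulr_ge0 // normc_ge0.
move=> Ht.
pose G i := x i * (w t i)%:C.
(* Elements of [J] outside [A t] have weight 0, so all of [J] may be summed. *)
have -> : \sum_(i <- A t) G i = \sum_(i <- J) G i + \sum_(i <- [seq i <- A t | i \notin J]) G i.
  rewrite (bigID (mem J)) /= big_filter; congr (_ + _).
  rewrite [RHS](bigID (mem (A t))) /= [X in _ + X]big1 ?addr0; last first.
    by move=> i /A0 wi; rewrite /G wi mulr0.
  rewrite -big_filter -[RHS]big_filter; apply: perm_big; apply: uniq_perm.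
  - exact: filter_uniq.
  - exact/filter_uniq/fset_uniq.
  by move=> i; rewrite !mem_filter andbC.
set S := summability.sum _.
have -> : l%:C * S - (\sum_(i <- J) G i + \sum_(i <- [seq i <- A t | i \notin J]) G i) =
   l%:C * (S - \sum_(i <- J) x i) + (\sum_(i <- J) x i * (l - w t i)%:C
     - \sum_(i <- [seq i <- A t | i \notin J]) G i).
  have -> : \sum_(i <- J) x i * (l - w t i)%:C = l%:C * \sum_(i <- J) x i - \sum_(i <- J) G i.
    rewrite mulr_sumr -sumrB; apply: eq_bigr => i _.
    by rewrite rmorphB /= mulrBr mulrC.
  by rewrite mulrBr opprD !addrA subrK.
apply: le_trans (le_normcD _ _) _.
have -> : e = `|l| * d + (d + `|C| * d).
  by rewrite /d; field; rewrite gt_eqF // ltr_wpDl.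
apply: lerD; first by rewrite Normc.normcM normc_real ler_wpM2l.
apply: le_trans (le_normcD _ _) _; rewrite normcN; apply: lerD.
  apply: le_trans (normc_sum _ _ _) _; apply: le_trans Ht; apply: ler_sum => i _.
  by rewrite Normc.normcM normc_real distrC.
apply: le_trans (normc_sum _ _ _) _.
apply: (@le_trans _ _ (\sum_(i <- [seq i <- A t | i \notin J]) `|C| * normc (x i))).
  apply: ler_sum => i _; rewrite Normc.normcM normc_real mulrC.
  by rewrite ler_wpM2r ?normc_ge0 // (le_trans (wC i)) // ler_norm.
rewrite -mulr_sumr ler_wpM2l //.
have := HJ [fset i in [seq i <- A t | i \notin J]]%fset.
rewrite (perm_big [seq i <- A t | i \notin J]) /=.
  by apply=> i; rewrite !inE mem_filter => /andP[].
apply: uniq_perm; rewrite ?fset_uniq ?filter_uniq // => i.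
by rewrite !inE.
Qed.

End unordered_sums.

(** * The mean value *)

Section finite_forms.
Variables (R : realType) (k : nat).
Implicit Types (F G : {ffun 'I_k -> nat} -> R[i]) (x : R).

Lemma convolutionE X F G n : n \in hyperbolic_seq k X ->
  convolution F G n = \sum_(d <- hyperbolic_seq k X | vdvd d n) F d * G (vdiv n d).
Proof.
move=> nA; rewrite -big_filter fsbig_seq; last exact/filter_uniq/hyperbolic_seq_uniq.
apply: eq_fsbigl; apply/seteqP; split => d /=; rewrite mem_filter.
  by move=> dn; have dn' : vdvd d n by [apply/forallP]; rewrite dn' (vdvd_mem nA dn').
by move=> /andP[/forallP].
Qed.

Lemma hyperbolic_sumE F x : 0 <= x ->
  hyperbolic_sum F x = \sum_(n <- hyperbolic_seq k (Num.truncn x)) F n.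
Proof.
move=> x0; rewrite fsbig_seq ?hyperbolic_seq_uniq //; apply: eq_fsbigl.
apply/seteqP; split => n /=; rewrite -truncn_ge_nat //; first by move=> /hyperbolic_seqP.
by move=> /hyperbolic_seqP.
Qed.

Lemma hyperbolic_countE x (d : {ffun 'I_k -> nat}) : 0 <= x -> (0 < vprod d)%N ->
  hyperbolic_count k (Num.truncn x).+1 (x / (vprod d)%:R) =
  \sum_(m <- hyperbolic_seq k (Num.truncn x)) (vprod d * vprod m <= Num.truncn x)%N%:R.
Proof.
move=> x0 d0; rewrite big_filter big_image_cond /= [RHS]big_mkcond /=.
apply: eq_bigr => m _.
have E : (\prod_(i < k) (m i).+1)%N = vprod [ffun i => (m i : nat).+1].
  by apply: eq_bigr => i _; rewrite ffunE.
rewrite E ler_pdivlMr ?ltr0n // -natrM mulnC -truncn_ge_nat //.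
(* Points of the box outside the list have product above X, and multiplying by [vprod d >= 1] keeps
   it there. *)
case: ifPn => // /negbTE mX; rewrite leqNgt (leq_trans _ (leq_pmull _ d0)) //.
by rewrite ltnNge mX.
Qed.

Lemma vprod_posvec (n : {ffun 'I_k -> nat}) : posvec k n <-> (0 < vprod n)%N.
Proof.
split=> [n0|]; first by rewrite prodn_gt0.
by move=> n0 i; move: n0; rewrite /vprod (bigD1 i) //= muln_gt0 => /andP[].
Qed.

Lemma mem_hyperbolic_seqE X (n : {ffun 'I_k -> nat}) :
  (n \in hyperbolic_seq k X) = (0 < vprod n <= X)%N.
Proof.
apply/hyperbolic_seqP/andP => -[n0 nX]; split=> //; exact/vprod_posvec.
Qed.

End finite_forms.

(** * The limit for k+1 variables *)

Section mean_value.
Variables (R : realType) (k : nat) (F : {ffun 'I_k.+1 -> nat} -> R[i]).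
Hypothesis hF : abs_cvg_series (mobius_quotient F).

Let A (x : R) := hyperbolic_seq k.+1 (Num.truncn x).

Let weight (x : R) (d : {ffun 'I_k.+1 -> nat}) : R :=
  hyperbolic_count k.+1 (Num.truncn x).+1 (x / (vprod d)%:R) * (vprod d)%:R
  / (x * ln x ^+ k).

(** This is the summand inside [multiseries], so its unordered sum is the constant of the theorem by
    definition. *)
Let coef d : R[i] := if d \in posvec k.+1 then mobius_quotient F d else 0.

Lemma coef_small_tails : small_tails (fun d => Normc.normc (coef d)).
Proof.
apply: esum_small_tails => [d|]; first exact: normc_ge0.
move: hF; rewrite /abs_cvg_series (esum_mkcond (posvec _)); apply: le_lt_trans.
apply: le_esum => d _; rewrite /coef; case: ifP => // _.
by rewrite Normc.normc0.
Qed.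

(** Either some entry is 0 and the factor [vprod d] vanishes, or x / [vprod d] < 1 and the count
    does. *)
Lemma weight_eq0 x d : 0 < x -> d \notin A x -> weight x d = 0.
Proof.
move=> x0; rewrite mem_hyperbolic_seqE /weight; case: posnP => [->|d0] /=.
  by rewrite mulr0 mul0r.
rewrite -ltnNge truncn_lt_nat ?ltW // => xd.
by rewrite hyperbolic_count_lt1 ?mul0r // ltr_pdivrMr ?ltr0n // mul1r.
Qed.

Lemma weight_le x d : expR 1 <= x -> `|weight x d| <= k.+1%:R ^+ k / k`!%:R.
Proof.
move=> xe; have x0 : 0 < x by exact: lt_le_trans (expR_gt0 _) xe.
have [dA|dA] := boolP (d \in A x); last first.
  by rewrite weight_eq0 // normr0 divr_ge0 ?exprn_ge0.
move: dA; rewrite mem_hyperbolic_seqE => /andP[d0 _].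
rewrite ger0_norm; first by rewrite hyperbolic_weight_le // ler1n.
rewrite divr_ge0 ?mulr_ge0 ?hyperbolic_count_ge0 ?(ltW x0) //.
rewrite exprn_ge0 // ln_ge0 //; apply: le_trans xe.
by rewrite -[leLHS]expR0 ler_expR.
Qed.

Lemma weight_cvg d : coef d != 0 -> weight x d @[x --> +oo] --> (k`!%:R^-1 : R).
Proof.
rewrite /coef; case: ifPn => [|_]; last by rewrite eqxx.
rewrite inE => /vprod_posvec d0 _.
apply: hyperbolic_weight_cvg; first by rewrite ler1n.
by move=> x x0; have /andP[_ /ltW] := truncn_itv x0.
Qed.

(** The denominator in [coef] cancels the factor [vprod d] of [weight], which leaves
    [sum_via_mobius]. *)
Lemma hyperbolic_sum_weight x : 0 < x ->
  ((x * ln x ^+ k)^-1)%:C * hyperbolic_sum F x = \sum_(d <- A x) coef d * (weight x d)%:C.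
Proof.
move=> x0; rewrite hyperbolic_sumE ?ltW // sum_via_mobius mulr_sumr.
apply: eq_big_seq => d dA; have := dA.
rewrite mem_hyperbolic_seqE => /andP[d0 _].
rewrite -convolutionE // /coef ifT; last by rewrite inE; exact/vprod_posvec.
rewrite /mobius_quotient -/(vprod d) /weight hyperbolic_countE ?ltW //.
rewrite 2!rmorphM /= rmorph_nat rmorph_sum /=.
under [in RHS]eq_bigr do rewrite rmorph_nat.
have dn : (vprod d)%:R != 0 :> R[i] by rewrite pnatr_eq0 -lt0n.
by move: ((x * ln x ^+ k)^-1)%:C => p; field.
Qed.

Lemma hyperbolic_sum_cvg :
  (((x * ln x ^+ k)^-1)%:C * hyperbolic_sum F x : R[i]^o) @[x --> +oo]
    --> ((k`!%:R^-1)%:C * multiseries (mobius_quotient F) : R[i]^o).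
Proof.
have nearA : \forall x \near +oo, [/\ uniq (A x),
    (forall d, d \notin A x -> weight x d = 0) &
    forall d, `|weight x d| <= k.+1%:R ^+ k / k`!%:R].
  near=> x; have xe : expR 1 < x by near: x; apply: nbhs_pinfty_gt; exact: num_real.
  split=> [|d|d]; first exact: hyperbolic_seq_uniq.
  - exact: weight_eq0 (lt_trans (expR_gt0 1) xe).
  - exact: weight_le (ltW xe).
have H := dominated_sum_cvg (@proper_pinfty_nbhs R) coef_small_tails nearA (@weight_cvg).
apply: cvg_trans H; apply: near_eq_cvg; near=> x.
have x0 : 0 < x by near: x; apply: nbhs_pinfty_gt; exact: num_real.
by rewrite hyperbolic_sum_weight.
Unshelve. all: end_near.
Qed.

End mean_value.

Theorem theorem2p1 (R : realType) (k : nat) (hk : (1 <= k)%N)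
    (F : {ffun 'I_k -> nat} -> R[i])
    (hF : abs_cvg_series (mobius_quotient F)) :
  (((x * ln x ^+ k.-1)^-1)%:C * hyperbolic_sum F x : R[i]^o) @[x --> +oo]
    --> ((k.-1)`!%:R^-1 * multiseries (mobius_quotient F) : R[i]^o).
Proof.
case: k hk F hF => // k _ F hF /=.
rewrite [X in _ --> X](_ : _ = (k`!%:R^-1)%:C * multiseries (mobius_quotient F) :> R[i]^o);
  last by rewrite fmorphV rmorph_nat.
exact: hyperbolic_sum_cvg.
Qed.
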